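(* Let $G$ be an $(r,s)$-directed hypergraph. On the region of real pairs $(p,q)$ with $p,q\ge1$ and $r/p+s/q<1$, the function $$(p,q)\mapsto (r|G|)^{r/p}(s|G|)^{s/q}\lambda_{p,q}(G)$$ is non-increasing in $p$ and non-increasing in $q$.
   Context: Let $r,s$ be positive integers. An $(r,s)$-directed hypergraph $G$ consists of a finite vertex set $V(G)$ and a finite set $E(G)$ of arcs. Each arc $e$ is an ordered pair $(T(e),H(e))$ of disjoint subsets of $V(G)$ (tail and head) with $|T(e)|=r$ and $|H(e)|=s$. Write $T(G)=\bigcup_eT(e)$, $H(G)=\bigcup_eH(e)$, and $|G|=|E(G)|$. For real vectors $\mathbf{x}=(x_u)_{u\in T(G)}$ and $\mathbf{y}=(y_v)_{v\in H(G)}$, indexed independently, set $P_G(\mathbf x,\mathbf y)=\sum_{e\in E(G)}\prod_{u\in T(e)}x_u\prod_{v\in H(e)}y_v$. For real $p,q\ge1$ let $\lambda_{p,q}(G)=\max\{P_G(\mathbf x,\mathbf y):\|\mathbf x\|_p=\|\mathbf y\|_q=1\}$. *)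

(* Defs.v *)
From HB Require Import structures.
From mathcomp Require Import all_boot all_order all_algebra.
From mathcomp Require Import all_classical all_reals all_analysis.

Set Implicit Arguments.
Unset Strict Implicit.
Unset Printing Implicit Defensive.

Import Order.TTheory GRing.Theory Num.Theory.
Import numFieldTopology.Exports numFieldNormedType.Exports.

Local Open Scope ring_scope.

(* An arc [e] is the pair of its tail [e.1] and its head [e.2]. *)
Record dihypergraph (r s : nat) (V : finType) := Dihypergraph {
  arcs : {set {set V} * {set V}};
  arcsP : forall e, e \in arcs ->
    [/\ #|e.1| = r, #|e.2| = s & [disjoint e.1 & e.2]] }.

Definition tails r s V (G : dihypergraph r s V) : {set V} :=
  (\bigcup_(e in arcs G) e.1)%SET.

Definition heads r s V (G : dihypergraph r s V) : {set V} :=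
  (\bigcup_(e in arcs G) e.2)%SET.

(* The index types of the vectors x and y: a vertex that is both in some tail
   and in some head indexes a coordinate of each, and the two are unrelated. *)
Definition tail_vertex r s V (G : dihypergraph r s V) : finType :=
  {u : V | u \in tails G}.

Definition head_vertex r s V (G : dihypergraph r s V) : finType :=
  {v : V | v \in heads G}.

Section Spectral.
Variables (R : realType) (r s : nat) (V : finType) (G : dihypergraph r s V).

Definition pnorm (I : finType) (p : R) (x : I -> R) : R :=
  (\sum_i `|x i| `^ p) `^ p^-1.

Definition arc_form (x : tail_vertex G -> R) (y : head_vertex G -> R) : R :=
  \sum_(e in arcs G) ((\prod_(u : tail_vertex G | val u \in e.1) x u) *
                      (\prod_(v : head_vertex G | val v \in e.2) y v)).

Definition unit_pairs (p q : R) :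
    set ((tail_vertex G -> R) * (head_vertex G -> R)) :=
  [set xy | pnorm p xy.1 = 1 /\ pnorm q xy.2 = 1]%classic.

(* The supremum is a maximum as soon as [G] has an arc, see [spectral_radius_max];
   without arcs there are no vectors of norm 1 and it is [sup set0 = 0]. *)
Definition spectral_radius (p q : R) : R :=
  sup [set arc_form xy.1 xy.2 | xy in unit_pairs p q]%classic.

Definition normalized_radius (p q : R) : R :=
  (r * #|arcs G|)%N%:R `^ (r%:R / p) * (s * #|arcs G|)%N%:R `^ (s%:R / q)
  * spectral_radius p q.

End Spectral.

Arguments arc_form {R r s V} G x y.
Arguments unit_pairs {R r s V} G p q _.

Definition admissible (R : realType) (r s : nat) (p q : R) : Prop :=
  [/\ 1 <= p, 1 <= q & r%:R / p + s%:R / q < 1].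

Section Maximum.
Import ArrowAsProduct.
Variable R : realType.

Let pnorm_eq1 (I : finType) (p : R) (x : I -> R) : 1 <= p ->
  pnorm p x = 1 <-> \sum_i `|x i| `^ p = 1.
Proof.
move=> p1; have p0 : 0 < p by exact: lt_le_trans ltr01 p1.
have S0 : 0 <= \sum_i `|x i| `^ p by apply: sumr_ge0 => i _; exact: powR_ge0.
rewrite /pnorm; split=> [|->]; last by rewrite powR1.
move=> /(congr1 (fun t => t `^ p)).
by rewrite -powRrM mulVf ?gt_eqF// powRr1// powR1.
Qed.

Let pnorm_witness (I : finType) (p : R) (i0 : I) : 1 <= p ->
  pnorm p (fun i : I => (i == i0)%:R : R) = 1.
Proof.
move=> p1; apply/pnorm_eq1 => //.
have p0 : p != 0 by rewrite gt_eqF// (lt_le_trans ltr01 p1).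
rewrite (bigD1 i0)//= eqxx normr1 powR1 big1 ?addr0// => i /negbTE ->.
by rewrite normr0 powR0.
Qed.

Let norm_powR_continuous (p : R) : 1 <= p ->
  continuous (fun t : R => `|t| `^ p).
Proof.
move=> p1 t; have p0 : 0 < p by exact: lt_le_trans ltr01 p1.
have [->|t0] := eqVneq t 0.
  rewrite /continuous_at normr0 powR0 ?gt_eqF//.
  apply: (@squeeze_cvgr _ _ _ _ (fun=> 0) (fun u : R => `|u|)).
  - near=> u; rewrite powR_ge0/=.
    have [->|u0] := eqVneq u 0; first by rewrite normr0 powR0 ?gt_eqF.
    rewrite ge1r_powR// normr_gt0 u0/=.
    near: u; exists 1 => //= u /=; rewrite sub0r normrN; exact: ltW.
  - exact: cvg_cst.
  - by have := @norm_continuous R R 0; rewrite /continuous_at normr0.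
apply: (@continuous_comp _ _ _ (Num.norm : R -> R) (fun a : R => a `^ p)).
  exact: norm_continuous.
apply: differentiable_continuous; apply/derivable1_diffP.
by apply: derivable_powR; rewrite in_itv/= andbT normr_gt0.
Unshelve. all: by end_near. Qed.

Let big_continuous (T : topologicalType) (I : Type) (l : seq I) (P : pred I)
    (F : I -> T -> R) : (forall i, continuous (F i)) ->
  continuous (fun x => \sum_(i <- l | P i) F i x) /\
  continuous (fun x => \prod_(i <- l | P i) F i x).
Proof.
move=> cF; elim: l => [|i l [IHs IHp]].
  by split=> x; under eq_fun do rewrite big_nil; exact: cvg_cst.
split=> x; under eq_fun do rewrite big_cons; case: (P i).
- exact: (cvgD (cF i x) (IHs x)).
- exact: IHs.
- exact: (cvgM (cF i x) (IHp x)).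
- exact: IHp.
Qed.

Let coord_continuous (I : finType) (i : I) :
  continuous (fun x : I -> R => x i).
Proof. exact: (@proj_continuous I (fun=> R) i). Qed.

Let compact_sphere (I : finType) (p : R) : 1 <= p ->
  compact [set x : I -> R | pnorm p x = 1]%classic.
Proof.
move=> p1; have p0 : 0 < p by exact: lt_le_trans ltr01 p1.
apply: (@subclosed_compact _ _
  [set x : forall i : I, R | forall i, `[-1, 1]%classic (x i)]%classic).
- rewrite (_ : [set _ | _]%classic =
      ((fun x : I -> R => \sum_i `|x i| `^ p) @^-1` [set 1])%classic).
    apply: closed_comp; last exact: closed_eq.
    move=> x _.
    apply: (big_continuous _ _ _).1 => i {}x.
    apply: (@continuous_comp _ _ _ (fun x : I -> R => x i)
                             (fun t : R => `|t| `^ p)).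
      exact: coord_continuous.
    exact: norm_powR_continuous.
  by apply/seteqP; split=> x /=; rewrite pnorm_eq1.
- apply: (@tychonoff I (fun=> R) (fun=> `[-1, 1]%classic)) => _.
  exact: segment_compact.
- move=> x /=; rewrite pnorm_eq1// => x1 i.
  have xE : `|x i| = (`|x i| `^ p) `^ p^-1.
    by rewrite -powRrM mulfV ?gt_eqF// powRr1.
  have x_le1 : `|x i| `^ p <= 1.
    rewrite -x1 (bigD1 i)//= lerDl; apply: sumr_ge0 => j _; exact: powR_ge0.
  rewrite in_itv/= -ler_norml xE.
  have <- : 1 `^ p^-1 = 1 :> R by rewrite powR1.
  apply: ge0_ler_powR; rewrite ?nnegrE ?powR_ge0 ?ler01//.
  by rewrite invr_ge0 ltW.
Qed.

Lemma spectral_radius_max (r s : nat) (V : finType) (G : dihypergraph r s V)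
    (p q : R) : (0 < r)%N -> (0 < s)%N -> (0 < #|arcs G|)%N ->
    1 <= p -> 1 <= q ->
  exists x y, [/\ pnorm p x = 1, pnorm q y = 1,
    arc_form G x y = spectral_radius G p q &
    forall x' y', pnorm p x' = 1 -> pnorm q y' = 1 ->
      arc_form G x' y' <= spectral_radius G p q].
Proof.
move=> r0 s0 /card_gt0P[e eG] p1 q1.
have [e1 e2 _] := arcsP eG.
have /card_gt0P[u ue] : (0 < #|e.1|)%N by rewrite e1.
have /card_gt0P[v ve] : (0 < #|e.2|)%N by rewrite e2.
have uT : u \in tails G by apply/finset.bigcupP; exists e.
have vH : v \in heads G by apply/finset.bigcupP; exists e.
have [|||[x y] /set_mem [/= x1 y1] xymax] := @compact_EVT_max _ R
    (fun xy => arc_form G xy.1 xy.2) (unit_pairs G p q).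
- by exists (fun i => (i == exist _ u uT)%:R, fun i => (i == exist _ v vH)%:R);
    split; exact: pnorm_witness.
- exact: compact_setX (compact_sphere p1) (compact_sphere q1).
- apply: continuous_subspaceT.
  pose T := ((tail_vertex G -> R) * (head_vertex G -> R))%type.
  have cX (a : {set V} * {set V}) : continuous (fun xy : T =>
      \prod_(i : tail_vertex G | val i \in a.1) xy.1 i).
    apply: (@big_continuous T _ _ _ (fun i xy => xy.1 i) _).2 => i z.
    apply: (@continuous_comp T _ _ fst (fun x : tail_vertex G -> R => x i)).
      exact: cvg_fst.
    exact: coord_continuous.
  have cY (a : {set V} * {set V}) : continuous (fun xy : T =>
      \prod_(i : head_vertex G | val i \in a.2) xy.2 i).
    apply: (@big_continuous T _ _ _ (fun i xy => xy.2 i) _).2 => i z.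
    apply: (@continuous_comp T _ _ snd (fun x : head_vertex G -> R => x i)).
      exact: cvg_snd.
    exact: coord_continuous.
  apply: (@big_continuous T _ _ _ (fun (a : {set V} * {set V}) (xy : T) =>
    (\prod_(i : tail_vertex G | val i \in a.1) xy.1 i) *
    (\prod_(i : head_vertex G | val i \in a.2) xy.2 i)) _).1 => a z.
  exact: (cvgM (cX a z) (cY a z)).
have le_xy x' y' : pnorm p x' = 1 -> pnorm q y' = 1 ->
    arc_form G x' y' <= arc_form G x y.
  by move=> ? ?; apply: (xymax (x', y')); apply/mem_set.
have supE : arc_form G x y = spectral_radius G p q.
  apply/eqP; rewrite eq_le; apply/andP; split.
    apply: ub_le_sup; last by exists (x, y).
    by exists (arc_form G x y) => _ [[x' y'] [/= ? ?] <-]; exact: le_xy.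
  apply: ge_sup; first by exists (arc_form G x y), (x, y).
  by move=> _ [[x' y'] [/= ? ?] <-]; exact: le_xy.
by exists x, y; split=> //; rewrite -supE.
Qed.

End Maximum.

(* Main.v *)
Require Import Defs.
From mathcomp Require Import all_boot all_order all_algebra.
From mathcomp Require Import all_classical all_reals all_analysis.
From mathcomp Require Import ring lra.

Import Order.TTheory GRing.Theory Num.Theory.

Local Open Scope ring_scope.

(** Fix nonnegative arc weights [w], here the products of the other vector over
    the arcs, and an optimal nonnegative [x] of [p2]-norm 1. With
    [t = p2 / p1 >= 1] the vector [x^t] has [p1]-norm 1, and Bernoulli's
    inequality [z^t >= 1 + t (z - 1)] at [z = c X_e], [c = (r|G|)^(r/p2)], gives
    [c^t M1 >= t c M2 - (t - 1) W], where [M1], [M2] are the two maxima and [W]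
    is the total weight. Since [c^t = (r|G|)^(r/p1)], it remains that
    [W <= c M2], which a constant vector shows, as there are at most [r|G|]
    tail vertices. *)

(** Young's inequality for [a] and 1, with exponents [t] and [(1 - t^-1)^-1], gives this after
    multiplication by [t]. The case [t = 1], which has no finite conjugate exponent, is separate. *)
Lemma bernoulli_powR (R : realType) (a t : R) :
  0 <= a -> 1 <= t -> 1 + t * (a - 1) <= a `^ t.
Proof.
move=> a0; rewrite le_eqVlt => /predU1P[<-|t1].
  by rewrite powRr1// mul1r addrC subrK.
have t0 : 0 < t by exact: lt_trans t1.
have q0 : 0 < 1 - t^-1 by rewrite subr_gt0 invf_lt1.
have := @conjugate_powR R a 1 t (1 - t^-1)^-1 a0 ler01 t0.
rewrite invr_gt0 invrK powR1 mulr1 mul1r => /(_ q0).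
rewrite [_ + (1 - _)]addrC subrK => /(_ erefl).
rewrite -(ler_pM2l t0) mulrDr mulrCA mulfV ?gt_eqF// mulrBr mulfV ?gt_eqF//.
by lra.
Qed.

Lemma powR_prod (R : realType) (I : Type) (l : seq I) (P : pred I)
    (F : I -> R) (t : R) : (forall i, 0 <= F i) ->
  (\prod_(i <- l | P i) F i) `^ t = \prod_(i <- l | P i) F i `^ t.
Proof.
move=> F0; elim: l => [|i l IHl]; first by rewrite !big_nil powR1.
by rewrite !big_cons; case: (P i); rewrite // powRM ?IHl// prodr_ge0.
Qed.

Lemma pnorm_norm (R : realType) (I : finType) (p : R) (x : I -> R) :
  pnorm p (fun i => `|x i|) = pnorm p x.
Proof. by rewrite /pnorm; under eq_bigr do rewrite normr_id. Qed.

Lemma pnorm_powR (R : realType) (I : finType) (p1 p2 : R) (x : I -> R) :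
    0 < p1 -> 0 < p2 -> pnorm p2 x = 1 ->
  pnorm p1 (fun i => `|x i| `^ (p2 / p1)) = 1.
Proof.
move=> p1_gt0 p2_gt0 x1; rewrite /pnorm.
under eq_bigr do rewrite ger0_norm ?powR_ge0// -powRrM divfK ?gt_eqF//.
(* The inner sum is now that of [|x i| ^ p2]; splitting the outer exponent exposes [pnorm p2 x]. *)
have -> : p1^-1 = p2^-1 * (p2 / p1) by rewrite mulKf ?gt_eqF.
by rewrite powRrM [X in X `^ _]x1 powR1.
Qed.

Lemma pnorm_const (R : realType) (I : finType) (p : R) :
  0 < p -> (0 < #|I|)%N -> pnorm p (fun _ : I => #|I|%:R `^ (- p^-1)) = 1.
Proof.
move=> p0 I0; rewrite /pnorm; under eq_bigr do rewrite ger0_norm ?powR_ge0//.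
rewrite sumr_const -powRrM mulNr mulVf ?gt_eqF// powR_inv1// -[X in X `^ _]mulr_natl.
by rewrite mulfV ?powR1// pnatr_eq0 -lt0n.
Qed.

Lemma pnorm_card_gt0 (R : realType) (I : finType) (p : R) (x : I -> R) :
  0 < p -> pnorm p x = 1 -> (0 < #|I|)%N.
Proof.
move=> p0 x1; rewrite lt0n; apply/negP => /eqP/card0_eq I0; move: x1.
rewrite /pnorm big_pred0// powR0 ?invr_eq0 ?gt_eqF// => /esym/eqP.
by rewrite oner_eq0.
Qed.

(** [I] stands for the side whose exponent varies, so that one lemma serves tails and heads. [M1]
    need only be an upper bound for this [w]: weights taken from a maximiser at [p2] may be
    suboptimal at [p1]. *)
Lemma weighted_form_max_le (R : realType) (I E : finType) (A : {set E})
    (S : E -> pred I) (w : E -> R) (n k : nat) (p1 p2 M1 M2 : R) (x : I -> R) :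
    0 < p1 -> p1 <= p2 ->
    (forall e, e \in A -> #|S e| = k) -> (#|I| <= n)%N ->
    (forall e, 0 <= w e) ->
    (forall z, pnorm p1 z = 1 ->
       \sum_(e in A) (\prod_(i | S e i) z i) * w e <= M1) ->
    (forall z, pnorm p2 z = 1 ->
       \sum_(e in A) (\prod_(i | S e i) z i) * w e <= M2) ->
    pnorm p2 x = 1 ->
    M2 <= \sum_(e in A) (\prod_(i | S e i) `|x i|) * w e ->
  n%:R `^ (k%:R / p2) * M2 <= n%:R `^ (k%:R / p1) * M1.
Proof.
move=> p1_gt0 p12 cardS leIn w0 max1 max2 x1 xmax.
have p2_gt0 : 0 < p2 by exact: lt_le_trans p12.
have I0 := pnorm_card_gt0 _ _ _ _ p2_gt0 x1.
have t1 : 1 <= p2 / p1 by rewrite ler_pdivlMr// mul1r.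
set t := p2 / p1 in t1.
set c := n%:R `^ (k%:R / p2).
have c0 : 0 <= c by exact: powR_ge0.
have -> : n%:R `^ (k%:R / p1) = c `^ t.
  by rewrite -powRrM /t mulrA divfK ?gt_eqF.
set W := \sum_(e in A) w e.
have W0 : 0 <= W by exact: sumr_ge0.
have leW : W <= c * M2.
  (* The constant vector of [p2]-norm 1 makes every product of [k] coordinates equal to [1 / d], so
     the form takes the value [W / d]. Since [M2 >= 0], [d] may then be enlarged to [c]. *)
  set d := (#|I|%:R : R) `^ (k%:R / p2).
  have d0 : 0 < d by rewrite powR_gt0// ltr0n.
  have dM : W / d <= M2.
    rewrite mulr_suml; apply: le_trans (max2 _ (pnorm_const R I _ p2_gt0 I0)).
    apply: ler_sum => e eA; rewrite prodr_const (cardS e eA).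
    by rewrite -powR_mulrn ?powR_ge0// -powRrM mulNr powRN [p2^-1 * _]mulrC [_^-1 * _]mulrC.
  have M2_ge0 : 0 <= M2 by apply: le_trans dM; rewrite divr_ge0// ltW.
  move: dM; rewrite ler_pdivrMr// => /le_trans; apply.
  rewrite mulrC ler_wpM2r// ge0_ler_powR ?nnegrE ?ler0n ?ler_nat//.
  by rewrite divr_ge0// ltW.
set X := fun e => \prod_(i | S e i) `|x i|.
have X0 e : 0 <= X e by apply: prodr_ge0.
have leM1 : c `^ t * (\sum_(e in A) X e `^ t * w e) <= c `^ t * M1.
  apply: ler_wpM2l; first exact: powR_ge0.
  apply: le_trans (max1 _ (pnorm_powR _ _ _ _ _ p1_gt0 p2_gt0 x1)).
  by apply: ler_sum => e _; rewrite /X powR_prod.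
apply: le_trans leM1.
have tangent : \sum_(e in A) (1 + t * (c * X e - 1)) * w e <=
    c `^ t * \sum_(e in A) X e `^ t * w e.
  rewrite mulr_sumr; apply: ler_sum => e _.
  by rewrite mulrA -powRM// ler_wpM2r// bernoulli_powR// mulr_ge0.
apply: le_trans tangent.
have -> : \sum_(e in A) (1 + t * (c * X e - 1)) * w e =
    (1 - t) * W + t * (c * \sum_(e in A) X e * w e).
  rewrite /W !mulr_sumr -big_split/=; apply: eq_bigr => e _; ring.
have : c * M2 <= c * \sum_(e in A) X e * w e by exact: ler_wpM2l.
(* As [1 - t <= 0], [W <= cM] gives [(1 - t) W >= (1 - t) cM]; adding [t F >= t cM] leaves [cM]. *)
set F := c * \sum_(e in A) _; move: leW; set cM := c * M2; nra.
Qed.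

Lemma card_cover_le (E V : finType) (A : {set E}) (S : E -> {set V}) (k : nat) :
  (forall e, e \in A -> #|S e| = k) ->
  (#|(\bigcup_(e in A) S e)%SET| <= k * #|A|)%N.
Proof.
move=> cardS; rewrite mulnC -sum_nat_const.
rewrite -(eq_bigr _ cardS).
elim/big_rec2: _ => [|e m B _ leB]; first by rewrite cards0.
by apply: leq_trans (leq_card_setU _ _) _; rewrite leq_add2l.
Qed.

(** Coordinates are indexed by a subtype of [V]; this ensures that each arc still contributes
    exactly [r] tail factors and [s] head factors. *)
Lemma card_sig_subset (V : finType) (B C : {set V}) : B \subset C ->
  #|[pred u : {u : V | u \in C} | val u \in B]| = #|B|.
Proof.
move=> sBC; rewrite -(card_imset _ val_inj); apply: eq_card => v.
apply/imsetP/idP => [[u uB ->]//|vB].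
by exists (exist _ v (fintype.subsetP sBC v vB)).
Qed.

Lemma card_tail_vertex_le r s V (G : dihypergraph r s V) :
  (#|tail_vertex G| <= r * #|arcs G|)%N.
Proof.
rewrite card_sig; apply: (@card_cover_le _ _ _ (fun e => e.1)) => e eG.
by case: (arcsP eG).
Qed.

Lemma card_head_vertex_le r s V (G : dihypergraph r s V) :
  (#|head_vertex G| <= s * #|arcs G|)%N.
Proof.
rewrite card_sig; apply: (@card_cover_le _ _ _ (fun e => e.2)) => e eG.
by case: (arcsP eG).
Qed.

Lemma card_tail r s V (G : dihypergraph r s V) e : e \in arcs G ->
  #|[pred u : tail_vertex G | val u \in e.1]| = r.
Proof.
move=> eG; rewrite card_sig_subset; first by case: (arcsP eG).
exact: (finset.bigcup_sup e).
Qed.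

Lemma card_head r s V (G : dihypergraph r s V) e : e \in arcs G ->
  #|[pred v : head_vertex G | val v \in e.2]| = s.
Proof.
move=> eG; rewrite card_sig_subset; first by case: (arcsP eG).
exact: (finset.bigcup_sup e).
Qed.

(** Together with [pnorm_norm], this lets a maximising pair be replaced by its absolute values. *)
Lemma arc_form_le_norm (R : realType) r s V (G : dihypergraph r s V)
    (x : tail_vertex G -> R) (y : head_vertex G -> R) :
  arc_form G x y <= arc_form G (fun u => `|x u|) (fun v => `|y v|).
Proof.
apply: ler_sum => e _; apply: le_trans (ler_norm _) _.
by rewrite normrM !normr_prod.
Qed.

Lemma arc_formC (R : realType) r s V (G : dihypergraph r s V)
    (x : tail_vertex G -> R) (y : head_vertex G -> R) :
  arc_form G x y = \sum_(e in arcs G)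
    (\prod_(v : head_vertex G | val v \in e.2) y v) *
    (\prod_(u : tail_vertex G | val u \in e.1) x u).
Proof. by apply: eq_bigr => e _; rewrite mulrC. Qed.

(** The form is an empty sum, so its set of values is empty or the singleton of 0, and [sup] is 0
    either way. This settles the case that [spectral_radius_max] excludes. *)
Lemma spectral_radius0 (R : realType) r s V (G : dihypergraph r s V) (p q : R) :
  #|arcs G| = 0%N -> spectral_radius G p q = 0.
Proof.
move=> /eqP; rewrite cards_eq0 => /eqP G0; rewrite /spectral_radius.
set B := [set _ | _ in _]%classic.
have : (B `<=` [set 0])%classic.
  by move=> _ [xy _ <-] /=; rewrite /arc_form G0 big_set0.
by move=> /subset_set1[->|->]; rewrite ?sup0 ?sup1.
Qed.

Theorem theorem5p3 (R : realType) (r s : nat) (hr : (0 < r)%N) (hs : (0 < s)%N)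
    (V : finType) (G : dihypergraph r s V) :
  (forall p1 p2 q : R,
      admissible r s p1 q -> admissible r s p2 q -> p1 <= p2 ->
      normalized_radius G p2 q <= normalized_radius G p1 q) /\
  (forall p q1 q2 : R,
      admissible r s p q1 -> admissible r s p q2 -> q1 <= q2 ->
      normalized_radius G p q2 <= normalized_radius G p q1).
Proof.
have [G0|] := posnP #|arcs G|.
  by split=> *; rewrite /normalized_radius !spectral_radius0// !mulr0.
move=> G0; split=> [p1 p2 q [p1_ge1 q_ge1 _] [p2_ge1 _ _] p12
                   |p q1 q2 [p_ge1 q1_ge1 _] [_ q2_ge1 _] q12].
- rewrite /normalized_radius mulrAC [leRHS]mulrAC.
  apply: ler_wpM2r; first exact: powR_ge0.
  have [x [y [x1 y1 xyE max2]]] := @spectral_radius_max R r s V G _ _ hr hs G0 p2_ge1 q_ge1.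
  have [_ [_ [_ _ _ max1]]] := @spectral_radius_max R r s V G _ _ hr hs G0 p1_ge1 q_ge1.
  (* The factor in [q] is gone. Freezing [|y|], from the maximiser at [(p2, q)], as arc weights
     keeps every test pair admissible for both maxima. *)
  have y1' : pnorm q (fun v => `|y v|) = 1 by rewrite pnorm_norm.
  apply: (@weighted_form_max_le R _ _ (arcs G)
    (fun e => [pred u : tail_vertex G | val u \in e.1])
    (fun e => \prod_(v : head_vertex G | val v \in e.2) `|y v|)
    _ _ _ _ _ _ x) => //.
  + exact: lt_le_trans p1_ge1.
  + exact: card_tail.
  + exact: card_tail_vertex_le.
  + by move=> e; exact: prodr_ge0.
  + by move=> z z1; exact: max1 y1'.
  + by move=> z z1; exact: max2 y1'.
  + by rewrite -xyE; exact: arc_form_le_norm.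
- rewrite /normalized_radius -!mulrA.
  apply: ler_wpM2l; first exact: powR_ge0.
  have [x [y [x1 y1 xyE max2]]] := @spectral_radius_max R r s V G _ _ hr hs G0 p_ge1 q2_ge1.
  have [_ [_ [_ _ _ max1]]] := @spectral_radius_max R r s V G _ _ hr hs G0 p_ge1 q1_ge1.
  have x1' : pnorm p (fun u => `|x u|) = 1 by rewrite pnorm_norm.
  (* Now the tails supply the weights; [arc_formC] puts the head products first. *)
  apply: (@weighted_form_max_le R _ _ (arcs G)
    (fun e => [pred v : head_vertex G | val v \in e.2])
    (fun e => \prod_(u : tail_vertex G | val u \in e.1) `|x u|)
    _ _ _ _ _ _ y) => //.
  + exact: lt_le_trans q1_ge1.
  + exact: card_head.
  + exact: card_head_vertex_le.
  + by move=> e; exact: prodr_ge0.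
  + by move=> z z1; rewrite -arc_formC; exact: max1.
  + by move=> z z1; rewrite -arc_formC; exact: max2.
  + by rewrite -xyE -arc_formC; exact: arc_form_le_norm.
Qed.
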